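(* Let $G$ be a connected graph of order $n$ and size $m$, and let $\alpha\in[0,1)$. If $s_n=0$, then $$E(A_\alpha(G))\ge\frac{\alpha^2M_1+(1-\alpha)^2\,2m-\frac{4\alpha^2m^2}{n}}{s_1},$$ with equality if and only if any of the following holds: (i) $G$ has distinct $A_\alpha$-eigenvalues $\frac n2$, $\frac{n(2\alpha-1)}{2}$ and $\frac{n\alpha}{2}$, i.e. $G\cong K_{\frac n2,\frac n2}$; (ii) $G$ has distinct $A_\alpha$-eigenvalues $h+\frac{2m\alpha}{n}$, $-h+\frac{2m\alpha}{n}$ and $\frac{2m\alpha}{n}$ for some $h>\frac{2m}{n}(1-\alpha)$.
   Context: Graphs are finite and simple. For a graph $G$ with vertex degrees $d_1,\dots,d_n$ and $m$ edges, adjacency matrix $A(G)$ and diagonal degree matrix $D(G)$, $A_\alpha(G)=\alpha D(G)+(1-\alpha)A(G)$ with eigenvalues $p_1,\dots,p_n$ (the $A_\alpha$-eigenvalues). The numbers $s_1\ge s_2\ge\dots\ge s_n\ge0$ are the values $\left|p_i-\frac{2\alpha m}{n}\right|$, $i=1,\dots,n$, arranged in non-increasing order. The $A_\alpha$-energy is $E(A_\alpha(G))=\sum_{i=1}^n\left|p_i-\frac{2\alpha m}{n}\right|=\sum_{i=1}^n s_i$. The Zagreb index is $M_1=\sum_{i=1}^n d_i^2$. *)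

(* Defs.v *)
From mathcomp Require Import all_boot all_order all_algebra.
From mathcomp Require Import polyrcf complex.

Set Implicit Arguments.
Unset Strict Implicit.
Unset Printing Implicit Defensive.

Import Order.TTheory GRing.Theory Num.Theory.
Local Open Scope ring_scope.

(* A graph of order n is an adjacency relation on 'I_n. *)
Definition simple_graph (n : nat) (e : rel 'I_n) : Prop :=
  symmetric e /\ irreflexive e.

(* The graph with no vertex is not counted as connected. *)
Definition connected_graph (n : nat) (e : rel 'I_n) : Prop :=
  (0 < n)%N /\ forall x y : 'I_n, connect e x y.

Definition degree (n : nat) (e : rel 'I_n) (x : 'I_n) : nat := #|[set y | e x y]|.

Definition edges (n : nat) (e : rel 'I_n) : {set {set 'I_n}} :=
  [set [set xy.1; xy.2] | xy : 'I_n * 'I_n & e xy.1 xy.2].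

Definition graph_size (n : nat) (e : rel 'I_n) : nat := #|edges e|.

Definition zagreb1 (n : nat) (e : rel 'I_n) : nat :=
  (\sum_(i < n) degree e i ^ 2)%N.

Definition complete_bipartite (a b : nat) : rel ('I_a + 'I_b) :=
  fun u v => match u, v with
             | inl _, inr _ | inr _, inl _ => true
             | _, _ => false
             end.

Definition graph_iso (T U : finType) (e : rel T) (f : rel U) : Prop :=
  exists2 phi : T -> U, bijective phi & forall x y, f (phi x) (phi y) = e x y.

(* Eigenvalues in R, each repeated according to its algebraic multiplicity;
   by eigenvalues_symmetric below, nothing is lost on symmetric matrices. *)
Definition eigenvalues (R : rcfType) (n : nat) (A : 'M[R]_n) : seq R :=
  flatten [seq nseq (mup x (char_poly A)) x | x <- rootsR (char_poly A)].

Lemma char_poly_conj (F : fieldType) (n : nat) (P D : 'M[F]_n) :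
  P \in unitmx -> char_poly (invmx P *m D *m P) = char_poly D.
Proof.
move=> Pu; rewrite /char_poly.
have E : map_mx polyC (invmx P) *m map_mx polyC P = 1%:M.
  by rewrite -map_mxM mulVmx // map_mx1.
have -> : char_poly_mx (invmx P *m D *m P) =
   map_mx polyC (invmx P) *m char_poly_mx D *m map_mx polyC P.
  rewrite /char_poly_mx mulmxBr mulmxBl !map_mxM; congr (_ - _).
  by rewrite mul_mx_scalar -scalemxAl E scalemx1.
rewrite !det_mulmx mulrAC -det_mulmx E det1 mul1r //.
Qed.

Lemma char_poly_symmetric (R : rcfType) (n : nat) (A : 'M[R]_n) :
  A^T = A -> exists s : seq R, char_poly A = \prod_(x <- s) ('X - x%:P).
Proof.
move=> symA.
pose f : {rmorphism R -> R[i]} := real_complex R.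
pose B := map_mx f A.
have Breal : B \is a mxOver Num.real.
  by apply/mxOverP => i j; rewrite mxE; apply/complex_realP; exists (A i j).
have Bsym : B^T = B by apply/matrixP => i j; rewrite !mxE -{2}symA mxE.
have Bherm : B \is hermsymmx.
  by apply/is_hermitianmxP; rewrite scale1r realmxC ?Bsym // ; apply/mxOverP.
have Dreal := @hermitian_spectral_diag_real _ _ B Bherm.
have /orthomx_spectralP := hermitian_normalmx Bherm.
set P := spectralmx B; set d := spectral_diag B => defB.
have Pu : P \in unitmx := spectral_unit B.
have cpB : char_poly B = char_poly (diag_mx d) by rewrite defB char_poly_conj.
exists [seq complex.Re (d 0 i) | i : 'I_n].
apply: (@map_poly_inj _ _ f).
rewrite map_char_poly -/B cpB char_poly_trig ?diag_mx_is_trig //.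
rewrite big_map rmorph_prod big_enum; apply: eq_bigr => i _ /=.
rewrite rmorphB /= map_polyX map_polyC /= mxE eqxx mulr1n.
by rewrite RRe_real //; apply: (mxOverP Dreal).
Qed.

Lemma eigenvalues_symmetric (R : rcfType) (n : nat) (A : 'M[R]_n) :
  A^T = A -> char_poly A = \prod_(x <- eigenvalues A) ('X - x%:P).
Proof.
move=> /char_poly_symmetric[s def_s].
have nz : char_poly A != 0 by rewrite monic_neq0 ?char_poly_monic.
rewrite def_s; apply: perm_big; apply/allP => y _ /=; apply/eqP.
have on := roots_on_rootsR nz.
have Ur : uniq (rootsR (char_poly A)) by apply: uniq_roots.
rewrite /eigenvalues count_flatten -map_comp.
rewrite -mu_prod_XsubC -def_s sumnE big_map.
rewrite (eq_bigr (fun x => if x == y then mup y (char_poly A) else 0%N)); last first.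
  by move=> x _ /=; rewrite count_nseq /=; case: eqP => [->|_]; rewrite ?mul1n ?mul0n.
have := on y; rewrite inE /= => Ey.
case: (boolP (y \in rootsR (char_poly A))) => yr.
  by rewrite (bigD1_seq y) //= eqxx big1 ?addn0 // => x /negPf->.
rewrite big1_seq; last by move=> x /andP[_ xr]; case: eqP xr yr => // -> ->.
by apply: mupNroot; rewrite Ey.
Qed.

Section Spectrum.
Variable R : rcfType.

Definition has_distinct_eigenvalues (n : nat) (A : 'M[R]_n) (s : seq R) : Prop :=
  uniq s /\ forall x : R, eigenvalue A x = (x \in s).

Variables (n : nat) (e : rel 'I_n).

Definition adjacency_mx : 'M[R]_n := \matrix_(i, j) (e i j)%:R.

Definition degree_mx : 'M[R]_n := diag_mx (\row_i (degree e i)%:R).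

Definition Aalpha (alpha : R) : 'M[R]_n :=
  alpha *: degree_mx + (1 - alpha) *: adjacency_mx.

Definition Aalpha_mean (alpha : R) : R :=
  2 * alpha * (graph_size e)%:R / n%:R.

Definition Aalpha_energy (alpha : R) : R :=
  \sum_(p <- eigenvalues (Aalpha alpha)) `|p - Aalpha_mean alpha|.

(* s_1 >= ... >= s_n; s_i is the entry of index i - 1. *)
Definition Aalpha_dev (alpha : R) : seq R :=
  sort >=%R [seq `|p - Aalpha_mean alpha| | p <- eigenvalues (Aalpha alpha)].

End Spectrum.

(* Main.v *)
Require Import Defs.
From mathcomp Require Import all_boot all_order all_algebra.
From mathcomp Require Import polyrcf complex ring lra.

Set Implicit Arguments.
Unset Strict Implicit.
Unset Printing Implicit Defensive.

Import Order.TTheory GRing.Theory Num.Theory.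
Local Open Scope ring_scope.

(** Write mu = 2 alpha m / n and q_i = p_i - mu. Traces give sum q_i = 0, and
    sum q_i^2 is the numerator of the bound, so the bound is
    s_i >= s_i^2 / s_1 summed over i, with equality iff every |q_i| is 0 or s_1.
    As sum q_i = 0 and s_n = 0, this says that the spectrum is
    {mu + h, mu - h, mu} for some h > 0. In that case Q = A_alpha - mu I
    satisfies Q^3 = h^2 Q; testing Q against the all-ones vector gives
    h >= (2 m / n) (1 - alpha), and in case of equality that vector is an
    eigenvector, so G is regular of some degree r, its adjacency matrix A
    satisfies A^3 = r^2 A, and counting walks of length 3 shows that G is
    K_{r,r}. *)

(** * Spectra of real symmetric matrices *)

(** Over [R[i]] the matrix is Hermitian, so the spectral theorem diagonalizes it with real diagonal;
    unique factorization of [char_poly A] matches that diagonal with [eigenvalues A]. Since [P]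
    stays complex, identities over [R] are checked through the injective embedding
    [real_complex R]. *)
Lemma spectral_symmetric (R : rcfType) (n : nat) (A : 'M[R]_n) :
  A^T = A ->
  exists (P : 'M[R[i]]_n) (d : 'rV[R]_n),
    [/\ P \in unitmx,
        map_mx (real_complex R) A =
          invmx P *m map_mx (real_complex R) (diag_mx d) *m P
      & perm_eq (eigenvalues A) [seq d 0 i | i <- enum 'I_n]].
Proof.
move=> symA; pose f : {rmorphism R -> R[i]} := real_complex R.
pose B := map_mx f A.
have Breal : B \is a mxOver Num.real.
  by apply/mxOverP => i j; rewrite mxE; apply/complex_realP; exists (A i j).
have Bherm : B \is hermsymmx.
  have Bsym : B^T = B by rewrite map_trmx symA.
  by apply/is_hermitianmxP; rewrite scale1r realmxC Bsym.
have /mxOverP Dreal := @hermitian_spectral_diag_real _ _ B Bherm.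
have /orthomx_spectralP := hermitian_normalmx Bherm.
set P := spectralmx B; set d := spectral_diag B => defB.
have Pu : P \in unitmx := spectral_unit B.
have def_d : d = map_mx f (\row_i complex.Re (d 0 i)).
  by apply/rowP => i; rewrite !mxE /= RRe_real.
exists P, (\row_i complex.Re (d 0 i)); rewrite map_diag_mx -def_d; split=> //.
apply: prod_XsubC_eq; rewrite -eigenvalues_symmetric //.
apply: (@map_poly_inj _ _ f); rewrite map_char_poly -/B defB char_poly_conj //.
rewrite char_poly_trig ?diag_mx_is_trig // big_map map_prod_XsubC big_enum.
by apply: eq_bigr => i _; rewrite !mxE eqxx mulr1n /= RRe_real.
Qed.

Lemma mulmx_conj (F : fieldType) (n : nat) (P X Y : 'M[F]_n) : P \in unitmx ->
  (invmx P *m X *m P) *m (invmx P *m Y *m P) = invmx P *m (X *m Y) *m P.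
Proof. by move=> Pu; rewrite !mulmxA mulmxK. Qed.

Lemma mxtrace_conj (F : fieldType) (n : nat) (P X : 'M[F]_n) : P \in unitmx ->
  \tr (invmx P *m X *m P) = \tr X.
Proof. by move=> Pu; rewrite mxtrace_mulC mulmxA mulmxV // mul1mx. Qed.

Section Eigenvalues.
Variables (R : rcfType) (n : nat) (A : 'M[R]_n).
Hypothesis symA : A^T = A.
Let f : {rmorphism R -> R[i]} := real_complex R.

Lemma size_eigenvalues : size (eigenvalues A) = n.
Proof.
have [P [d [_ _ /perm_size->]]] := spectral_symmetric symA.
by rewrite size_map size_enum_ord.
Qed.

Lemma mem_eigenvalues x : (x \in eigenvalues A) = eigenvalue A x.
Proof.
by rewrite eigenvalue_root_char eigenvalues_symmetric // root_prod_XsubC.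
Qed.

Lemma sum_eigenvalues : \sum_(p <- eigenvalues A) p = \tr A.
Proof.
have [P [d [Pu defA dE]]] := spectral_symmetric symA.
apply: (fmorph_inj f); rewrite (perm_big _ dE) /= big_map big_enum /=.
by rewrite -mxtrace_diag -!trace_map_mx defA mxtrace_conj.
Qed.

Lemma sum_sqr_eigenvalues : \sum_(p <- eigenvalues A) p ^+ 2 = \tr (A *m A).
Proof.
have [P [d [Pu defA dE]]] := spectral_symmetric symA.
apply: (fmorph_inj f); rewrite (perm_big _ dE) /= big_map big_enum /=.
transitivity (f (\tr (diag_mx d *m diag_mx d))).
  congr (f _); rewrite mulmx_diag mxtrace_diag.
  by apply: eq_bigr => i _; rewrite mxE.
by rewrite -!trace_map_mx !map_mxM defA mulmx_conj // mxtrace_conj.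
Qed.

(** A polynomial identity valid at each eigenvalue holds for the diagonal matrix, hence for its
    conjugate. This one expresses that the spectrum lies in {c, c + h, c - h}. *)
Lemma cube_sub_scalar_symmetric c h :
  {in eigenvalues A, forall p, (p - c) ^+ 3 = h ^+ 2 * (p - c)} ->
  let Q := A - c%:M in Q *m (Q *m Q) = h ^+ 2 *: Q.
Proof.
move=> Ac; have [P [d [Pu defA dE]]] := spectral_symmetric symA.
pose D := diag_mx d - c%:M.
have defQ : map_mx f (A - c%:M) = invmx P *m map_mx f D *m P.
  rewrite !raddfB /= defA mulmxBl; congr (_ - _).
  by rewrite !map_scalar_mx mul_mx_scalar -scalemxAl mulVmx // scalemx1.
have D3 : D *m (D *m D) = h ^+ 2 *: D.
  have -> : D = diag_mx (\row_i (d 0 i - c)).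
    by apply/matrixP=> i j; rewrite !mxE; case: eqP => _; rewrite ?mulr1n ?mulr0n ?subr0.
  rewrite !mulmx_diag -linearZ /=; congr diag_mx; apply/rowP=> i; rewrite !mxE -Ac.
    by rewrite !exprS expr0 mulr1.
  by rewrite (perm_mem dE); apply/map_f; rewrite mem_enum.
apply: (map_mx_inj (f := f)); rewrite map_mxZ map_mxM map_mxM defQ.
rewrite (mulmx_conj _ _ Pu) (mulmx_conj _ _ Pu) -map_mxM -map_mxM D3 map_mxZ.
by rewrite -scalemxAr -scalemxAl.
Qed.

End Eigenvalues.

(** * Quadratic forms of symmetric matrices with Q^3 = h^2 Q *)

Section CubeEquation.
Variables (R : realFieldType) (n : nat) (Q : 'M[R]_n) (h : R).
Hypotheses (symQ : Q^T = Q) (h_gt0 : 0 < h) (Q3 : Q *m (Q *m Q) = h ^+ 2 *: Q).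

Let dot (x y : 'cV[R]_n) : R := (x^T *m y) 0 0.

Let dotE x y : dot x y = \sum_i x i 0 * y i 0.
Proof. by rewrite /dot mxE; apply: eq_bigr => i _; rewrite mxE. Qed.

Let dotQ x y : dot x (Q *m y) = dot (Q *m x) y.
Proof. by rewrite /dot trmx_mul symQ mulmxA. Qed.

Let dot_ge0 x : 0 <= dot x x.
Proof. by rewrite dotE sumr_ge0 // => i _; rewrite -expr2 sqr_ge0. Qed.

Let dot_eq0 x : dot x x = 0 -> x = 0.
Proof.
rewrite dotE => /eqP; rewrite psumr_eq0; last by move=> i _; rewrite -expr2 sqr_ge0.
move=> /allP x0; apply/colP=> i; rewrite mxE; apply/eqP.
by have := x0 i (mem_index_enum _); rewrite mulf_eq0 orbb.
Qed.

Let dotBZ (a : R) x y :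
  dot (a *: x - y) (a *: x - y) = a ^+ 2 * dot x x - 2 * a * dot x y + dot y y.
Proof.
rewrite !dotE !mulr_sumr -sumrN -!big_split /=.
by apply: eq_bigr => i _; rewrite !mxE; ring.
Qed.

(* On {0, h, - h}, h - q = ((h - q)^2 + (h^2 - q^2)^2 / h^2) / (2 h). *)
Let dot_defect x :
  2 * h ^+ 3 * (h * dot x x - dot x (Q *m x)) =
  h ^+ 2 * dot (h *: x - Q *m x) (h *: x - Q *m x)
  + dot (h ^+ 2 *: x - Q *m (Q *m x)) (h ^+ 2 *: x - Q *m (Q *m x)).
Proof.
have E1 : dot x (Q *m (Q *m x)) = dot (Q *m x) (Q *m x) by rewrite dotQ.
(* The cubic equation enters here, as Q^4 = h^2 Q^2. *)
have E2 : dot (Q *m (Q *m x)) (Q *m (Q *m x)) = h ^+ 2 * dot (Q *m x) (Q *m x).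
  have -> : Q *m (Q *m x) = (Q *m Q) *m x by rewrite mulmxA.
  rewrite [in LHS]/dot [in LHS]trmx_mul trmx_mul symQ.
  rewrite -/(dot _ _) -!mulmxA (mulmxA Q Q x) (mulmxA Q (Q *m Q) x) Q3.
  by rewrite -scalemxAl -!scalemxAr mxE /dot trmx_mul symQ !mulmxA.
by rewrite !dotBZ E1 E2; ring.
Qed.

(** Up to the positive factor 2 h^3, [dot_defect] writes the gap as a sum of two nonnegative terms,
    which avoids diagonalizing [Q]. *)
Lemma cube_quadratic_le (x : 'cV[R]_n) : (x^T *m (Q *m x)) 0 0 <= h * (x^T *m x) 0 0.
Proof.
have h3 : 0 < 2 * h ^+ 3 by rewrite mulr_gt0 ?exprn_gt0.
rewrite -subr_ge0 -(pmulr_rge0 _ h3) (dot_defect x).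
by rewrite addr_ge0 ?dot_ge0 // mulr_ge0 ?dot_ge0 ?sqr_ge0.
Qed.

(** When the gap is zero both squares vanish, and the first is a positive multiple of the squared
    norm of h x - Q x. *)
Lemma cube_quadratic_eq (x : 'cV[R]_n) :
  (x^T *m (Q *m x)) 0 0 = h * (x^T *m x) 0 0 -> Q *m x = h *: x.
Proof.
move=> xE; have {}xE : dot x (Q *m x) = h * dot x x by [].
have := dot_defect x; rewrite xE subrr mulr0 => /esym/eqP.
rewrite paddr_eq0 ?dot_ge0 //; last by rewrite mulr_ge0 ?dot_ge0 ?sqr_ge0.
case/andP=> + _; rewrite mulf_eq0 sqrf_eq0.
by rewrite (gt_eqF h_gt0) => /eqP/dot_eq0/eqP; rewrite subr_eq0 => /eqP->.
Qed.

End CubeEquation.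

(** * Regular graphs and complete bipartite graphs *)

(** Both sides count ordered adjacent pairs: grouped by first component they give degrees, grouped
    by underlying set they give two per edge. *)
Lemma handshake (n : nat) (e : rel 'I_n) : simple_graph e ->
  (\sum_(i < n) degree e i = 2 * graph_size e)%N.
Proof.
move=> [e_sym e_irr].
rewrite (eq_bigr (fun i => \sum_(j | e i j) 1)%N); last first.
  by move=> i _; rewrite sum1_card; apply: eq_card => j; rewrite inE.
rewrite pair_big_dep /=.
rewrite (partition_big (fun p => [set p.1; p.2]) (mem (edges e))) /=; last first.
  by move=> p ep; apply/imsetP; exists p; rewrite ?inE.
transitivity (\sum_(E in edges e) 2)%N; last by rewrite sum_nat_const mulnC.
apply: eq_bigr => E /imsetP[[a b]].
rewrite inE /= => eab ->.
have neq_ab : (a == b) = false by apply/eqP=> ab; rewrite ab e_irr in eab.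
have <- : #|[set (a, b); (b, a)]| = 2%N by rewrite cards2 xpair_eqE neq_ab.
rewrite sum1_card; apply: eq_card => -[x y]; rewrite !inE !xpair_eqE unfold_in /=.
(* A pair with underlying set {a, b} has its components there, and they differ by irreflexivity. *)
apply/andP/orP => [[exy /eqP/setP xyab]|]; last first.
  by case=> /andP[/eqP-> /eqP->]; rewrite ?(e_sym b) eab // setUC.
have /orP[/eqP xE | /eqP xE] : (x == a) || (x == b) by have := xyab x; rewrite !inE eqxx.
  have /orP[/eqP yE | /eqP yE] : (y == a) || (y == b).
  - by have := xyab y; rewrite !inE eqxx orbT.
  - by rewrite xE yE e_irr in exy.
  - by left; rewrite xE yE !eqxx.
have /orP[/eqP yE | /eqP yE] : (y == a) || (y == b).
- by have := xyab y; rewrite !inE eqxx orbT.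
- by right; rewrite xE yE !eqxx.
- by rewrite xE yE e_irr in exy.
Qed.

(** K_{k,k} seen inside ['I_n] through one colour class, so that arguments on vertices need no sum
    type. *)
Definition bipartition (n : nat) (e : rel 'I_n) (k : nat) (X : {set 'I_n}) : Prop :=
  [/\ #|X| = k, #|~: X| = k & forall x y, e x y = ((x \in X) != (y \in X))].

(** Enumerating [X] and its complement separately gives an injection from the sum type, bijective by
    cardinality. *)
Lemma bipartition_iso (n : nat) (e : rel 'I_n) (k : nat) (X : {set 'I_n}) :
  bipartition e k X -> graph_iso e (@complete_bipartite k k).
Proof.
move=> [cX cXC eE].
pose psi (u : 'I_k + 'I_k) : 'I_n :=
  match u with
  | inl i => enum_val (cast_ord (esym cX) i)
  | inr i => enum_val (cast_ord (esym cXC) i)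
  end.
have psiX u : (psi u \in X) = (if u is inl _ then true else false).
  case: u => i /=; first exact: enum_valP.
  by apply/negbTE; have := enum_valP (cast_ord (esym cXC) i); rewrite inE.
have psi_inj : injective psi.
  move=> u v uv; have := congr1 (mem X) uv; rewrite /= !psiX.
  by case: u v uv => [i|i] [j|j] //= /enum_val_inj/cast_ord_inj->.
have [|phi psiK phiK] := inj_card_bij psi_inj.
  by rewrite card_sum !card_ord -{1}cX -cXC cardsC card_ord.
exists phi; first by exists psi.
move=> x y; rewrite -{2}(phiK x) -{2}(phiK y) eE !psiX.
by case: (phi x) (phi y) => [i|i] [j|j].
Qed.

Lemma iso_bipartition (n : nat) (e : rel 'I_n) (k : nat) :
  graph_iso e (@complete_bipartite k k) -> exists X, bipartition e k X.
Proof.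
move=> [phi [psi phiK psiK] eE].
pose in1 (u : 'I_k + 'I_k) := if u is inl _ then true else false.
have inl_inj : injective (fun i : 'I_k => psi (inl i)).
  by move=> i j /(can_inj psiK)[].
have inr_inj : injective (fun i : 'I_k => psi (inr i)).
  by move=> i j /(can_inj psiK)[].
exists [set x | in1 (phi x)]; split.
- rewrite -[RHS](card_ord k) -[RHS](card_image inl_inj); apply: eq_card => x.
  rewrite inE; apply/idP/imageP => [|[i _ ->]]; last by rewrite psiK.
  by case E: (phi x) => [i|i] // _; exists i => //; rewrite -E phiK.
- rewrite -[RHS](card_ord k) -[RHS](card_image inr_inj); apply: eq_card => x.
  rewrite !inE; apply/idP/imageP => [|[i _ ->]]; last by rewrite psiK.
  by case E: (phi x) => [i|i] // _; exists i => //; rewrite -E phiK.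
- by move=> x y; rewrite -eE !inE; case: (phi x) (phi y) => [i|i] [j|j].
Qed.

(** * Walks of length 3 and the recognition of K_{r,r} *)

Section Adjacency.
Variables (R : rcfType) (n : nat) (e : rel 'I_n).
Hypothesis Gsimple : simple_graph e.
Local Notation A := (adjacency_mx R e).

Lemma adjacency_mx_sym : A^T = A.
Proof. by case: Gsimple => e_sym _; apply/matrixP=> i j; rewrite !mxE e_sym. Qed.

Lemma adjacency_row_sum i : \sum_j A i j = (degree e i)%:R.
Proof.
rewrite /degree -sum1_card natr_sum [RHS]big_mkcond /=.
by apply: eq_bigr => j _; rewrite mxE inE; case: (e i j).
Qed.

Lemma adjacency_col_sum j : \sum_i A i j = (degree e j)%:R.
Proof.
by rewrite -adjacency_row_sum; apply: eq_bigr => i _; rewrite -{1}adjacency_mx_sym mxE.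
Qed.

(* The entry (i, j) of A^3 counts the walks of length 3; on an edge it can
   only reach r^2 if every pair in N(i) x N(j) is an edge. *)
Lemma cube_adjacency_edge (r : nat) :
  (forall i, degree e i = r) -> A *m (A *m A) = r%:R ^+ 2 *: A ->
  forall i j a b, e i j -> e i a -> e b j -> e a b.
Proof.
move=> reg A3 i j a b eij eia ebj.
have S0 : \sum_a \sum_b A i a * A b j * (1 - A a b) = 0.
  transitivity (\sum_a \sum_b A i a * A b j - (A *m (A *m A)) i j).
    rewrite [X in _ - X]mxE -sumrB; apply: eq_bigr => a' _.
    rewrite [X in _ - _ * X]mxE mulr_sumr -sumrB; apply: eq_bigr => b' _.
    by ring.
  rewrite A3 !mxE eij mulr1.
  rewrite (eq_bigr (fun a' => A i a' * r%:R)); last first.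
    by move=> a' _; rewrite -mulr_sumr adjacency_col_sum reg.
  by rewrite -mulr_suml adjacency_row_sum reg -expr2 subrr.
have ge0 a' b' : 0 <= A i a' * A b' j * (1 - A a' b').
  by rewrite !mxE; case: (e i a'); case: (e b' j); case: (e a' b');
     rewrite ?(mul0r, mul1r, subr0, subrr).
have Sa : \sum_b A i a * A b j * (1 - A a b) = 0.
  by apply: (psumr_eq0P _ S0) => // a' _; apply: sumr_ge0 => b' _; apply: ge0.
have : A i a * A b j * (1 - A a b) = 0.
  by apply: (psumr_eq0P _ Sa) => // b' _; apply: ge0.
rewrite !mxE eia ebj !mul1r; case: (e a b) => // /eqP.
by rewrite subr0 oner_eq0.
Qed.

(** For an edge i0 j0, all neighbours of j0 have the neighbourhood of i0, and all neighbours of i0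
    that of j0. These two neighbourhoods are complementary, so N(i0) serves as a colour class. *)
Lemma cube_adjacency_bipartition (r : nat) :
  (0 < r)%N -> (0 < n)%N -> (forall x y, connect e x y) ->
  (forall i, degree e i = r) -> A *m (A *m A) = r%:R ^+ 2 *: A ->
  exists X, bipartition e r X.
Proof.
move=> r_gt0 n_gt0 conn reg A3; have [e_sym e_irr] := Gsimple.
have full := cube_adjacency_edge reg A3.
pose N x := [set y | e x y]; have cN x : #|N x| = r := reg x.
pose i0 := Ordinal n_gt0.
have [j0 ej0] : exists j, e i0 j.
  have /card_gt0P[j] : (0 < #|N i0|)%N by rewrite cN.
  by rewrite inE; exists j.
(* All neighbourhoods have r elements, so one inclusion suffices. *)
have NE u v : N u \subset N v -> N v = N u.
  by move=> sub; apply/esym/eqP; rewrite eqEcard sub !cN leqnn.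
have Nj y : e j0 y -> N y = N i0.
  move=> ey; apply: NE; apply/subsetP=> x; rewrite !inE => ex.
  by rewrite e_sym; apply: (full i0 j0) => //; rewrite e_sym.
have Ni x : e i0 x -> N x = N j0.
  move=> ex; apply: NE; apply/subsetP=> y; rewrite !inE => ey.
  by apply: (full i0 j0) => //; rewrite e_sym.
(* The union of the two neighbourhoods is closed under adjacency and contains j0; connectedness
   makes it everything. *)
have cover x : e i0 x || e j0 x.
  have cl : closed e [pred x | e i0 x || e j0 x].
    apply: (intro_closed (sym_connect_sym e_sym)) => u v euv /orP[eu|eu].
      by apply/orP; right; have := Ni u eu => /setP/(_ v); rewrite !inE euv.
    by apply/orP; left; have := Nj u eu => /setP/(_ v); rewrite !inE euv.
  by have := closed_connect cl (conn j0 x); rewrite !inE ej0 => <-.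
have NiC : ~: N i0 = N j0.
  apply/setP=> x; rewrite !inE; have := cover x.
  (* A common element x would lie in N(i0) = N(x), against irreflexivity. *)
  case: (boolP (e i0 x)) => //= ex _; apply/esym/negbTE/negP => ex'.
  by have := Nj x ex' => /setP/(_ x); rewrite !inE ex e_irr.
exists (N i0); split; rewrite ?NiC ?cN // => x y.
have NiE z : (z \in N i0) = e i0 z by rewrite inE.
have NjE z : ~~ e i0 z = e j0 z by rewrite -NiE -in_setC NiC inE.
have -> : e x y = (y \in N x) by rewrite inE.
rewrite (NiE x); case: (boolP (e i0 x)) => ex.
  by rewrite (Ni x ex) -NiC inE; case: (y \in N i0).
by rewrite (Nj x) -?NjE //; case: (y \in N i0).
Qed.

Lemma bipartition_degree k X : bipartition e k X -> forall i, degree e i = k.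
Proof.
move=> [cX cXC eE] i; rewrite /degree.
case: (boolP (i \in X)) => iX; [rewrite -[RHS]cXC | rewrite -[RHS]cX].
  by apply: eq_card => j; rewrite !inE eE iX; case: (j \in X).
by apply: eq_card => j; rewrite !inE eE (negbTE iX); case: (j \in X).
Qed.

(** * The adjacency matrix of K_{k,k} *)

Section Bipartition.
Variables (k : nat) (X : {set 'I_n}).
Hypothesis biX : bipartition e k X.
(** With signs for the two classes, A = (J - chi chi^T) / 2 where J is the all-ones matrix, so
    matrix products become sums of polynomials in [chi]. *)
Let chi (i : 'I_n) : R := if i \in X then 1 else - 1.

Let chi2 i : chi i * chi i = 1.
Proof. by rewrite /chi; case: ifP; rewrite ?mulrNN mulr1. Qed.

Let adjE i j : A i j = (1 - chi i * chi j) / 2.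
Proof.
by case: biX => _ _ eE; rewrite mxE eE /chi; case: (i \in X); case: (j \in X) => /=; field.
Qed.

(** The classes have equal size, so the signs cancel, and there are 2k vertices. *)
Let sum_affine_chi p q : \sum_b (p + q * chi b) = p * (2 * k%:R).
Proof.
case: biX => cX cXC _; rewrite (bigID (mem X)) /=.
rewrite (eq_bigr (fun=> p + q)); last by move=> i iX; rewrite /chi iX mulr1.
rewrite [X in _ + X](eq_bigr (fun=> p - q)); last first.
  by move=> i iX; rewrite /chi (negbTE iX) mulrN1.
rewrite !sumr_const cX.
have -> : #|[pred i | i \notin X]| = k by rewrite -cXC; apply: eq_card => i; rewrite !inE.
by rewrite -[(p + q) *+ k]mulr_natr -[(p - q) *+ k]mulr_natr; ring.
Qed.

Lemma bipartition_cube : A *m (A *m A) = k%:R ^+ 2 *: A.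
Proof.
(* That is, A^2 = (k / 2) (J + chi chi^T). Each summand is affine in [chi b] once the square of
   [chi b] is replaced by 1. *)
have A2 i j : (A *m A) i j = k%:R / 2 * (1 + chi i * chi j).
  rewrite mxE (eq_bigr (fun b => (1 + chi i * chi j) / 4 + (- (chi i + chi j) / 4) * chi b)).
    by rewrite sum_affine_chi; field.
  move=> b _; rewrite !adjE.
  transitivity ((1 + chi i * chi j * (chi b * chi b)) / 4
                + (- (chi i + chi j) / 4) * chi b); first by field.
  by rewrite chi2 mulr1.
apply/matrixP=> i j; rewrite mxE.
rewrite (eq_bigr (fun b => k%:R / 4 * (1 - chi i * chi j)
                           + k%:R / 4 * (chi j - chi i) * chi b)).
  by rewrite sum_affine_chi mxE adjE; field.
move=> b _; rewrite A2 adjE.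
transitivity (k%:R / 4 * (1 - chi i * chi j * (chi b * chi b))
              + k%:R / 4 * (chi j - chi i) * chi b); first by field.
by rewrite chi2 mulr1.
Qed.

Lemma bipartition_eigenvector :
  (\row_i chi i) *m A = - k%:R *: \row_i chi i.
Proof.
apply/rowP=> j; rewrite mxE (eq_bigr (fun b => - chi j / 2 + 1 / 2 * chi b)).
  by rewrite sum_affine_chi !mxE; field.
move=> b _; rewrite mxE adjE.
transitivity (- chi j / 2 * (chi b * chi b) + 1 / 2 * chi b); first by field.
by rewrite chi2 mulr1.
Qed.

End Bipartition.

End Adjacency.

(** * The deviations and the traces of A_alpha *)

Section RealSequences.
Variable R : realFieldType.
Implicit Type s : seq R.

Lemma sum_sqr_div_le s M : 0 < M -> {in s, forall x, 0 <= x <= M} ->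
  (\sum_(x <- s) x ^+ 2) / M <= \sum_(x <- s) x.
Proof.
move=> M_gt0 sM; rewrite ler_pdivrMr // mulr_suml big_seq [leRHS]big_seq ler_sum // => x xs.
by have /andP[x0 xM] := sM x xs; rewrite expr2 ler_wpM2l.
Qed.

(** After multiplying by M, the difference of the two sides is the sum of the nonnegative terms x (M
    - x), which is zero only if each term is. *)
Lemma sum_sqr_div_eq s M : 0 < M -> {in s, forall x, 0 <= x <= M} ->
  \sum_(x <- s) x = (\sum_(x <- s) x ^+ 2) / M <->
  {in s, forall x, x = 0 \/ x = M}.
Proof.
move=> M_gt0 sM; have M_neq0 : M != 0 by rewrite gt_eqF.
have E : (\sum_(x <- s) x = (\sum_(x <- s) x ^+ 2) / M) <->
         \sum_(x <- s) x * (M - x) = 0.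
  have -> : \sum_(x <- s) x * (M - x) = (\sum_(x <- s) x) * M - \sum_(x <- s) x ^+ 2.
    by rewrite mulr_suml -sumrB; apply: eq_bigr => x _; ring.
  split=> [->|/eqP]; first by rewrite mulfVK ?subrr.
  by rewrite subr_eq0 => /eqP <-; rewrite mulfK.
rewrite E; split=> [/eqP|s0].
  rewrite big_seq psumr_eq0 => [/allP s0 x xs|x xs]; last first.
    by have /andP[x0 xM] := sM x xs; rewrite mulr_ge0 ?subr_ge0.
  have := s0 x xs; rewrite xs mulf_eq0 subr_eq0 => /orP[]/eqP ->; first by left.
  by right.
by rewrite big_seq big1 // => x /s0[]->; rewrite ?mul0r ?subrr ?mulr0.
Qed.

(** Otherwise all summands are nonnegative with sum zero, so each of them vanishes. *)
Lemma sum_sub0_lt s (mu : R) : \sum_(p <- s) (p - mu) = 0 ->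
  (exists2 p, p \in s & p != mu) -> exists2 p, p \in s & p < mu.
Proof.
move=> s0 [q qs q_mu]; apply/hasP; apply: contraNT q_mu => /hasPn s_ge.
have ge p : p \in s -> 0 <= p - mu by move=> /s_ge; rewrite -leNgt subr_ge0.
move/eqP: s0; rewrite big_seq psumr_eq0 // => /allP/(_ q qs).
by rewrite qs subr_eq0.
Qed.

Lemma sum_sub0_gt s (mu : R) : \sum_(p <- s) (p - mu) = 0 ->
  (exists2 p, p \in s & p != mu) -> exists2 p, p \in s & mu < p.
Proof.
move=> s0 [q qs q_mu]; apply/hasP; apply: contraNT q_mu => /hasPn s_le.
have ge p : p \in s -> 0 <= mu - p by move=> /s_le; rewrite -leNgt subr_ge0.
move/eqP: s0; rewrite -oppr_eq0 -sumrN (eq_bigr (fun p => mu - p)); last first.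
  by move=> p _; rewrite opprB.
rewrite big_seq psumr_eq0 // => /allP/(_ q qs).
by rewrite qs subr_eq0 eq_sym.
Qed.

Lemma nth_sort_ge s x : x \in s -> x <= (sort >=%R s)`_0.
Proof.
move=> xs; have ix : (index x (sort >=%R s) < size (sort >=%R s))%N.
  by rewrite index_mem mem_sort.
rewrite -[leLHS](nth_index 0 (s := sort >=%R s)) ?mem_sort //.
apply: (sorted_leq_nth (leT := >=%R)) => //.
- by move=> a b c ba cb; apply: le_trans cb ba.
- by move=> a; apply: lexx.
- by apply: sort_sorted => a b; rewrite le_total.
by rewrite inE (leq_ltn_trans _ ix).
Qed.

Lemma mem_nth_sort s i : (i < size s)%N -> (sort >=%R s)`_i \in s.
Proof. by move=> lt_i; rewrite -(mem_sort >=%R) mem_nth ?size_sort. Qed.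

End RealSequences.

Section AalphaMatrix.
Variables (R : rcfType) (n : nat) (e : rel 'I_n) (alpha : R).
Hypotheses (Gsimple : simple_graph e) (n_gt0 : (0 < n)%N).
Local Notation A := (adjacency_mx R e).
Local Notation B := (Aalpha e alpha).
Local Notation m := (graph_size e)%:R.
Local Notation mu := (Aalpha_mean e alpha).
Let one : 'cV[R]_n := const_mx 1.

Lemma Aalpha_sym : B^T = B.
Proof.
by rewrite /Aalpha linearD !linearZ /= tr_diag_mx adjacency_mx_sym.
Qed.

Lemma sum_degree : \sum_i (degree e i)%:R = 2 * m :> R.
Proof. by rewrite -natr_sum handshake // natrM. Qed.

Lemma Aalpha_diag i : B i i = alpha * (degree e i)%:R.
Proof. by case: Gsimple => _ e_irr; rewrite !mxE eqxx e_irr mulr0 addr0 mulr1n. Qed.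

Lemma Aalpha_off i j : i != j -> B i j = (1 - alpha) * (e i j)%:R.
Proof. by move=> /negPf ij; rewrite !mxE ij mulr0n mulr0 add0r. Qed.

Let row_sum_off i : \sum_(j | j != i) A i j = (degree e i)%:R.
Proof.
case: Gsimple => _ e_irr; rewrite -(adjacency_row_sum R).
by rewrite [RHS](bigD1 i) //= [A i i]mxE e_irr add0r.
Qed.

Lemma trace_Aalpha : \tr B = 2 * alpha * m.
Proof.
rewrite /mxtrace (eq_bigr _ (fun i _ => Aalpha_diag i)) -mulr_sumr sum_degree.
by ring.
Qed.

(** By symmetry the trace is the sum of squared entries: the diagonal yields M_1, and the 0/1
    adjacency entries are their own squares. *)
Lemma trace_Aalpha_sqr :
  \tr (B *m B) = alpha ^+ 2 * (zagreb1 e)%:R + (1 - alpha) ^+ 2 * (2 * m).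
Proof.
rewrite -sum_degree /zagreb1 natr_sum !mulr_sumr -big_split; apply: eq_bigr => i _ /=.
rewrite mxE (bigD1 i) //= Aalpha_diag.
rewrite (eq_bigr (fun j => (1 - alpha) ^+ 2 * A i j)) => [|j ij]; last first.
  have -> : B j i = B i j by rewrite -{1}Aalpha_sym mxE.
  rewrite Aalpha_off 1?eq_sym // mxE.
  by case: (e i j); rewrite ?mulr1 ?mulr0 ?mul0r // expr2.
by rewrite -mulr_sumr row_sum_off natrX; ring.
Qed.

(** The degree and adjacency matrices have the same row sums, so alpha cancels. *)
Lemma Aalpha_one i : (B *m one) i 0 = (degree e i)%:R.
Proof.
rewrite mxE (eq_bigr (fun j => B i j)) => [|j _]; last by rewrite [one _ _]mxE mulr1.
rewrite (bigD1 i) //= Aalpha_diag.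
rewrite (eq_bigr (fun j => (1 - alpha) * A i j)) => [|j ij]; last first.
  by rewrite Aalpha_off 1?eq_sym // mxE.
by rewrite -mulr_sumr row_sum_off; ring.
Qed.

(** The degree matrix is scalar here, so cubic relations pass between A_alpha, shifted, and A. *)
Lemma Aalpha_regular (r : nat) : (forall i, degree e i = r) ->
  B - (alpha * r%:R)%:M = (1 - alpha) *: A.
Proof.
move=> reg; apply/matrixP=> i j; rewrite !mxE reg.
by case: eqP => _; rewrite ?mulr1n ?mulr0n; ring.
Qed.

Lemma graph_size_regular (r : nat) : (forall i, degree e i = r) ->
  2 * m = n%:R * r%:R :> R.
Proof.
move=> reg; rewrite -sum_degree (eq_bigr (fun=> r%:R)) => [|i _]; last by rewrite reg.
by rewrite sumr_const card_ord mulr_natl.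
Qed.

Lemma mean_mul : n%:R * mu = 2 * alpha * m.
Proof. by rewrite mulrC mulfVK // pnatr_eq0 -lt0n. Qed.

Lemma sum_dev : \sum_(p <- eigenvalues B) (p - mu) = 0.
Proof.
rewrite sumrB (sum_eigenvalues Aalpha_sym) trace_Aalpha -mean_mul.
by rewrite big_const_seq count_predT (size_eigenvalues Aalpha_sym) iter_addr_0 -[mu *+ n]mulr_natl subrr.
Qed.

(** The centre is free: the mean gives the numerator of the bound, and 0 is used in
    [spectrum_balanced]. *)
Lemma sum_sqr_dev c : \sum_(p <- eigenvalues B) (p - c) ^+ 2 =
  alpha ^+ 2 * (zagreb1 e)%:R + (1 - alpha) ^+ 2 * (2 * m)
  - 4 * c * alpha * m + n%:R * c ^+ 2.
Proof.
rewrite (eq_bigr (fun p => p ^+ 2 + (- (2 * c) * p + c ^+ 2))) => [|p _]; last by ring.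
rewrite !big_split /= -mulr_sumr (sum_eigenvalues Aalpha_sym).
rewrite (sum_sqr_eigenvalues Aalpha_sym) trace_Aalpha trace_Aalpha_sqr.
rewrite big_const_seq count_predT (size_eigenvalues Aalpha_sym) iter_addr_0.
by rewrite -[_ *+ n]mulr_natl; ring.
Qed.

Lemma sum_sqr_dev_mean : \sum_(p <- eigenvalues B) (p - mu) ^+ 2 =
  alpha ^+ 2 * (zagreb1 e)%:R + (1 - alpha) ^+ 2 * (2 * m)
  - 4 * alpha ^+ 2 * m ^+ 2 / n%:R.
Proof.
have n0 : n%:R != 0 :> R by rewrite pnatr_eq0 -lt0n.
by rewrite sum_sqr_dev /Aalpha_mean; field.
Qed.

End AalphaMatrix.

(** * Spectra symmetric about the mean, and the equality case *)

Lemma connected_edge (n : nat) (e : rel 'I_n) :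
  (1 < n)%N -> connected_graph e -> exists x y, e x y.
Proof.
move=> n_gt1 [n_gt0 conn].
have /connectP[[|y p] /=] := conn (Ordinal n_gt0) (Ordinal n_gt1).
  by move=> _ /(congr1 val).
by case/andP=> exy _ _; exists (Ordinal n_gt0), y.
Qed.

Lemma bipartition_order (n : nat) (e : rel 'I_n) k X :
  bipartition e k X -> n = (2 * k)%N.
Proof. by case=> cX cXC _; rewrite -[LHS]card_ord -(cardsC X) cX cXC mul2n addnn. Qed.

(** Common form of both equality cases: (i) is the boundary value h = (2 m / n) (1 - alpha), (ii)
    any larger h. *)
Definition centered_spectrum (R : rcfType) (n : nat) (e : rel 'I_n) (alpha h : R) : Prop :=
  let mu := Aalpha_mean e alpha in
  has_distinct_eigenvalues (Aalpha e alpha) [:: h + mu; - h + mu; mu].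

Section ThreeEigenvalues.
Variables (R : rcfType) (n : nat) (e : rel 'I_n) (alpha : R).
Hypotheses (Gsimple : simple_graph e) (Gconn : connected_graph e).
Hypothesis alpha_lt1 : alpha < 1.
Local Notation A := (adjacency_mx R e).
Local Notation B := (Aalpha e alpha).
Local Notation m := (graph_size e)%:R.
Local Notation mu := (Aalpha_mean e alpha).
Hypothesis mu_in : mu \in eigenvalues B.
Let n_gt0 : (0 < n)%N := proj1 Gconn.
Let N_gt0 : 0 < n%:R :> R. Proof. by rewrite ltr0n. Qed.
Let symB : B^T = B := Aalpha_sym alpha Gsimple.
Let one : 'cV[R]_n := const_mx 1.

Local Notation spectrum := (centered_spectrum e alpha).

Let spectrum_cube h : spectrum h ->
  let Q := B - mu%:M in Q *m (Q *m Q) = h ^+ 2 *: Q.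
Proof.
move=> [_ specB]; apply: cube_sub_scalar_symmetric => // p.
rewrite mem_eigenvalues // specB !inE => /or3P[]/eqP->; ring.
Qed.

Let symQ : (B - mu%:M)^T = B - mu%:M.
Proof. by rewrite linearB /= symB tr_scalar_mx. Qed.

Let dev_one i : ((B - mu%:M) *m one) i 0 = (degree e i)%:R - mu.
Proof. by rewrite mulmxBl mul_scalar_mx mxE Aalpha_one // !mxE mulr1. Qed.

Let quad_one : (one^T *m ((B - mu%:M) *m one)) 0 0 = 2 * m * (1 - alpha).
Proof.
rewrite mxE (eq_bigr (fun i => (degree e i)%:R - mu)) => [|i _]; last first.
  by rewrite dev_one !mxE mul1r.
rewrite sumrB sum_degree // sumr_const card_ord -[mu *+ n]mulr_natl mean_mul //.
by ring.
Qed.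

Let norm_one : (one^T *m one) 0 0 = n%:R.
Proof.
rewrite mxE (eq_bigr (fun=> 1)) => [|i _]; last by rewrite !mxE mulr1.
by rewrite sumr_const card_ord.
Qed.

(** The all-ones vector gives the quadratic form of A_alpha - mu I the value 2 m - n mu = 2 m (1 -
    alpha), and has squared norm n. *)
Lemma spectrum_size_le (h : R) : 0 < h -> spectrum h -> 2 * m * (1 - alpha) <= h * n%:R.
Proof.
move=> h_gt0 /spectrum_cube Q3.
by rewrite -quad_one -norm_one; apply: cube_quadratic_le.
Qed.

Lemma spectrum_size_eq (h : R) : 0 < h -> spectrum h -> 2 * m * (1 - alpha) = h * n%:R ->
  exists k X, bipartition e k X.
Proof.
move=> h_gt0 /spectrum_cube Q3; rewrite -quad_one -norm_one.
move=> /(cube_quadratic_eq symQ h_gt0 Q3) Qone.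
(* Row i of the eigenvector equation reads d_i - mu = h, so the graph is regular. *)
have degE i : (degree e i)%:R = h + mu.
  have := congr1 (fun M : 'cV_n => M i 0) Qone; rewrite dev_one !mxE mulr1.
  by move=> <-; rewrite subrK.
pose r := degree e (Ordinal n_gt0).
have reg i : degree e i = r by apply/eqP; rewrite -(eqr_nat R) !degE.
have muE : mu = alpha * r%:R.
  apply: (mulfI (lt0r_neq0 N_gt0)); rewrite mean_mul // mulrAC.
  by rewrite (graph_size_regular R Gsimple reg); ring.
have hE : h = (1 - alpha) * r%:R.
  by have := degE (Ordinal n_gt0); rewrite -/r muE => rE; rewrite mulrBl mul1r {1}rE addrK.
have r_gt0 : (0 < r)%N.
  by rewrite -(ltr0n R); move: h_gt0; rewrite hE pmulr_rgt0 // subr_gt0.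
exists r; have [_ conn] := Gconn.
apply: (cube_adjacency_bipartition (R := R)) => //.
have a0 : 1 - alpha != 0 by rewrite subr_eq0 gt_eqF.
(* Now Q = (1 - alpha) A and h = (1 - alpha) r, so the factor (1 - alpha)^3 cancels. *)
move: Q3; rewrite /= muE (Aalpha_regular _ reg) hE.
rewrite -!scalemxAl -!scalemxAr !scalerA => Q3.
apply: (scalerI (mulf_neq0 a0 (mulf_neq0 a0 a0))).
by rewrite Q3 scalerA; congr (_ *: _); ring.
Qed.

(** All three values must occur: mu by [mu_in], and mu + h and mu - h because deviations with sum
    zero, not all zero, take both signs. *)
Lemma dev_spectrum (h : R) : 0 < h ->
  {in eigenvalues B, forall p, `|p - mu| = 0 \/ `|p - mu| = h} ->
  (exists2 p, p \in eigenvalues B & p != mu) -> spectrum h.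
Proof.
move=> h_gt0 devB p_neq; split.
  by rewrite /= !inE !negb_or; apply/and3P; split=> //; [apply/andP; split|];
     apply/eqP=> hE; lra.
have pE p : p \in eigenvalues B -> [\/ p = h + mu, p = - h + mu | p = mu].
  move=> /devB[/normr0_eq0|] pE; first by apply: Or33; lra.
  have [p_ge|p_lt] := leP 0 (p - mu).
    by rewrite ger0_norm // in pE; apply: Or31; lra.
  by rewrite ltr0_norm // in pE; apply: Or32; lra.
have s0 := sum_dev alpha Gsimple n_gt0.
move=> x; rewrite -mem_eigenvalues // !inE; apply/idP/or3P.
  by move=> /pE[] ->; [apply: Or31 | apply: Or32 | apply: Or33].
case=> /eqP-> //.
  have [q qB q_gt] := sum_sub0_gt s0 p_neq.
  by case: (pE q qB) => qE; [rewrite -qE | exfalso; lra | exfalso; lra].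
have [q qB q_lt] := sum_sub0_lt s0 p_neq.
by case: (pE q qB) => qE; [exfalso; lra | rewrite -qE | exfalso; lra].
Qed.

Lemma spectrum_dev (h : R) : 0 < h -> spectrum h ->
  {in eigenvalues B, forall p, `|p - mu| = 0 \/ `|p - mu| = h}.
Proof.
move=> h_gt0 [_ specB] p; rewrite mem_eigenvalues // specB !inE.
case/or3P=> /eqP->; rewrite ?addrK ?subrr ?normr0; last by left.
  by right; rewrite gtr0_norm.
by right; rewrite normrN gtr0_norm.
Qed.

(** The list is symmetric about c = n alpha / 2. The mean is an eigenvalue with eigenvalues on both
    sides, so it must be the middle one c. For alpha != 0 this determines m; for alpha = 0 it says
    nothing about m, and the trace of the square is used. *)
Lemma spectrum_balanced :
  has_distinct_eigenvalues B
    [:: n%:R / 2; n%:R * (2 * alpha - 1) / 2; n%:R * alpha / 2] ->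
  spectrum ((1 - alpha) * n%:R / 2) /\
  2 * m * (1 - alpha) = (1 - alpha) * n%:R / 2 * n%:R.
Proof.
move=> specB; set h := (1 - alpha) * n%:R / 2.
have h_gt0 : 0 < h by rewrite divr_gt0 ?mulr_gt0 ?subr_gt0.
set c := n%:R * alpha / 2.
have E1 : n%:R / 2 = h + c by rewrite /h /c; field.
have E2 : n%:R * (2 * alpha - 1) / 2 = - h + c by rewrite /h /c; field.
rewrite E1 E2 -/c in specB; have [_ inB] := specB.
have pE p : p \in eigenvalues B -> [\/ p = h + c, p = - h + c | p = c].
  rewrite mem_eigenvalues // inB !inE.
  by case/or3P=> /eqP ->; [apply: Or31 | apply: Or32 | apply: Or33].
have hc_in : h + c \in eigenvalues B by rewrite mem_eigenvalues // inB !inE eqxx.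
have hc'_in : - h + c \in eigenvalues B by rewrite mem_eigenvalues // inB !inE eqxx orbT.
have s0 := sum_dev alpha Gsimple n_gt0.
have p_neq : exists2 p, p \in eigenvalues B & p != mu.
  have [hc_mu|hc_mu] := eqVneq (h + c) mu; last by exists (h + c).
  by exists (- h + c) => //; apply/eqP; lra.
have [p pB p_lt] := sum_sub0_lt s0 p_neq; have [q qB q_gt] := sum_sub0_gt s0 p_neq.
have muE : mu = c.
  case: (pE _ mu_in) => // muE; exfalso.
    by case: (pE q qB) => qE; lra.
  by case: (pE p pB) => qE; lra.
rewrite /centered_spectrum muE; split=> //.
have [alpha0|alpha_neq0] := eqVneq alpha 0; last first.
  have := mean_mul e alpha n_gt0; rewrite muE /c => E.
  have {}E : 2 * m = n%:R / 2 * n%:R :> R.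
    apply: (mulfI alpha_neq0); transitivity (n%:R * (n%:R * alpha / 2)); last by field.
    by rewrite E; ring.
  by rewrite E /h; field.
(* For alpha = 0 the trace of B^2 is 2 m and at least 2 h^2. *)
have le_m := spectrum_size_le h_gt0; rewrite /centered_spectrum muE in le_m.
apply/eqP; rewrite eq_le le_m //=.
have := sum_sqr_dev alpha Gsimple 0; rewrite (big_rem _ hc_in) /=.
have hc'_rem : - h + c \in rem (h + c) (eigenvalues B).
  have := hc'_in; rewrite (perm_mem (perm_to_rem hc_in)) inE => /orP[/eqP|//] hE.
  by exfalso; lra.
rewrite (big_rem _ hc'_rem) /=.
set S := \sum_(_ <- _) _; have : 0 <= S by apply: sumr_ge0 => i _; apply: sqr_ge0.
have c0 : c = 0 by rewrite /c alpha0 mulr0 mul0r.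
(* Here h = n / 2, so the trace estimate becomes h n <= 2 m, the converse of [le_m]. *)
have hnE : h * n%:R = 2 * h ^+ 2 by rewrite /h alpha0; field.
rewrite hnE c0 alpha0 => S_ge0 E.
have {}E : 2 * h ^+ 2 + S = 2 * m by apply: etrans (etrans E _); ring.
by rewrite subr0 mulr1 -E lerDl.
Qed.

(** The cubic equation of A confines the deviations to 0, h and - h, the sign vector realizes - h,
    and [dev_spectrum] does the rest. That mu occurs comes from [mu_in]; it fails for K_{1,1}. *)
Lemma bipartition_spectrum k X : bipartition e k X ->
  has_distinct_eigenvalues B
    [:: n%:R / 2; n%:R * (2 * alpha - 1) / 2; n%:R * alpha / 2].
Proof.
move=> biX; have reg := bipartition_degree biX.
have nE : n%:R = 2 * k%:R :> R by rewrite -natrM -(bipartition_order biX).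
have muE : mu = alpha * k%:R.
  apply: (mulfI (lt0r_neq0 N_gt0)); rewrite mean_mul // mulrAC.
  by rewrite (graph_size_regular R Gsimple reg); ring.
set h := (1 - alpha) * k%:R.
have -> : n%:R * (2 * alpha - 1) / 2 = - h + mu by rewrite muE nE /h; field.
have -> : n%:R * alpha / 2 = mu by rewrite muE nE; field.
have -> : n%:R / 2 = h + mu by rewrite muE nE /h; field.
have h_gt0 : 0 < h.
  by rewrite mulr_gt0 ?subr_gt0 //; move: N_gt0; rewrite nE pmulr_rgt0.
have QE := Aalpha_regular alpha reg; rewrite -muE in QE.
have eigB x (v : 'rV[R]_n) : v *m B = x *: v -> v *m ((1 - alpha) *: A) = (x - mu) *: v.
  by move=> vB; rewrite -QE mulmxBr vB mul_mx_scalar scalerBl.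
have eigA x (v : 'rV[R]_n) : v *m A = x *: v -> v *m B = ((1 - alpha) * x + mu) *: v.
  move=> vA; have -> : B = (1 - alpha) *: A + mu%:M by rewrite -QE subrK.
  by rewrite mulmxDr -scalemxAr vA scalerA mul_mx_scalar scalerDl.
apply: dev_spectrum => // [p|].
  rewrite mem_eigenvalues // => /eigenvalueP[v /eigB vQ v_neq0].
  have Q3 : (1 - alpha) *: A *m ((1 - alpha) *: A *m ((1 - alpha) *: A)) =
            h ^+ 2 *: ((1 - alpha) *: A).
    rewrite -!scalemxAl -!scalemxAr (bipartition_cube _ biX) !scalerA.
    by congr (_ *: _); rewrite /h; ring.
  (* On the eigenvector v the cubic equation becomes (p - mu)^3 = h^2 (p - mu). *)
  have := congr1 (mulmx v) Q3; rewrite !mulmxA vQ -scalemxAl vQ -scalemxAl -scalemxAl vQ.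
  rewrite -scalemxAr vQ !scalerA => /eqP; rewrite -subr_eq0 -scalerBl scaler_eq0.
  rewrite (negPf v_neq0) orbF => /eqP p_cube.
  have : (p - mu) * ((p - mu - h) * (p - mu + h)) = 0 by rewrite -p_cube; ring.
  move/eqP; rewrite !mulf_eq0 => /or3P[]/eqP pE; [left | right | right].
  - by rewrite pE normr0.
  - by rewrite (_ : p - mu = h) ?gtr0_norm //; lra.
  - by rewrite (_ : p - mu = - h) ?normrN ?gtr0_norm //; lra.
exists (- h + mu); last by apply/eqP; lra.
rewrite mem_eigenvalues //; apply/eigenvalueP.
exists (\row_i (if i \in X then 1 else - 1)).
  by rewrite (eigA _ _ (bipartition_eigenvector R biX)) mulrN.
apply/eqP=> /rowP/(_ (Ordinal n_gt0)); rewrite !mxE.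
by case: ifP => _ /eqP; rewrite ?oppr_eq0 oner_eq0.
Qed.

End ThreeEigenvalues.

(** * Positivity of s_1, the bound and its equality case *)

Lemma Aalpha_dev_gt0 (R : rcfType) (n : nat) (e : rel 'I_n) (alpha : R) :
  simple_graph e -> connected_graph e -> (1 < n)%N -> alpha < 1 ->
  0 < (Aalpha_dev e alpha)`_0.
Proof.
move=> Gsimple Gconn n_gt1 alpha_lt1; have n_gt0 := proj1 Gconn.
set B := Aalpha e alpha; set mu := Aalpha_mean e alpha.
have symB : B^T = B := Aalpha_sym alpha Gsimple.
have ge_dev p : p \in eigenvalues B -> `|p - mu| <= (Aalpha_dev e alpha)`_0.
  by move=> pB; apply/nth_sort_ge/map_f.
rewrite lt_neqAle; apply/andP; split; last first.
  have : (Aalpha_dev e alpha)`_0 \in [seq `|p - mu| | p <- eigenvalues B].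
    by apply: mem_nth_sort; rewrite size_map size_eigenvalues.
  by case/mapP=> p _ ->.
apply/eqP=> s1_0.
have dev0 p : p \in eigenvalues B -> p = mu.
  move=> /ge_dev; rewrite -s1_0 normr_le0 subr_eq0 => /eqP //.
have S0 : \sum_(p <- eigenvalues B) (p - mu) ^+ 2 = 0.
  by rewrite big_seq big1 // => p /dev0->; rewrite subrr expr0n.
have : 0 < \sum_(p <- eigenvalues B) (p - mu) ^+ 2; last by rewrite S0 ltxx.
(* This is the squared Frobenius norm of A_alpha - mu I, split into diagonal and off-diagonal parts;
   the latter is positive as soon as there is an edge. *)
have -> : \sum_(p <- eigenvalues B) (p - mu) ^+ 2 =
  \sum_i (alpha * (degree e i)%:R - mu) ^+ 2 + (1 - alpha) ^+ 2 * (2 * (graph_size e)%:R).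
  rewrite sum_sqr_dev // /zagreb1.
  rewrite (eq_bigr (fun i => alpha ^+ 2 * (degree e i ^ 2)%:R
    + (- (2 * mu * alpha) * (degree e i)%:R + mu ^+ 2))) => [|i _]; last by rewrite natrX; ring.
  rewrite !big_split /= -2!mulr_sumr sum_degree // -natr_sum sumr_const card_ord.
  by rewrite -[mu ^+ 2 *+ n]mulr_natl; ring.
have m_gt0 : (0 < graph_size e)%N.
  have [x [y exy]] := connected_edge n_gt1 Gconn.
  by apply/card_gt0P; exists [set x; y]; apply/imsetP; exists (x, y); rewrite ?inE.
apply: ltr_wpDl; first by apply: sumr_ge0 => i _; apply: sqr_ge0.
by rewrite mulr_gt0 ?exprn_gt0 ?subr_gt0 // mulr_gt0 ?ltr0n.
Qed.

Theorem theorem4p5 (R : rcfType) (n : nat) (e : rel 'I_n) (alpha : R)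
    (Gsimple : simple_graph e) (Gconn : connected_graph e)
    (n_gt1 : (1 < n)%N)
    (alpha01 : 0 <= alpha < 1)
    (sn0 : (Aalpha_dev e alpha)`_n.-1 = 0) :
  let m : R := (graph_size e)%:R in
  let M1 : R := (zagreb1 e)%:R in
  let N : R := n%:R in
  let s1 : R := (Aalpha_dev e alpha)`_0 in
  let bound : R :=
    (alpha ^+ 2 * M1 + (1 - alpha) ^+ 2 * (2 * m)
       - 4 * alpha ^+ 2 * m ^+ 2 / N) / s1 in
  let spectrum_i : Prop :=
    has_distinct_eigenvalues (Aalpha e alpha)
      [:: N / 2; N * (2 * alpha - 1) / 2; N * alpha / 2] in
  let spectrum_ii : Prop :=
    exists2 h : R, 2 * m / N * (1 - alpha) < h &
      has_distinct_eigenvalues (Aalpha e alpha)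
        [:: h + 2 * m * alpha / N; - h + 2 * m * alpha / N;
            2 * m * alpha / N] in
  [/\ bound <= Aalpha_energy e alpha,
      Aalpha_energy e alpha = bound <-> spectrum_i \/ spectrum_ii
    & spectrum_i <->
        exists2 k : nat, n = (2 * k)%N & graph_iso e (@complete_bipartite k k)].
Proof.
move=> m M1 N s1 bound spectrum_i spectrum_ii.
have n_gt0 := proj1 Gconn; case/andP: alpha01 => alpha_ge0 alpha_lt1.
have symB := Aalpha_sym alpha Gsimple.
pose mu := Aalpha_mean e alpha; pose E := eigenvalues (Aalpha e alpha).
pose dev : seq R := [seq `|p - mu| | p <- E].
have s1_gt0 : 0 < s1 by apply: Aalpha_dev_gt0.
have N_gt0 : 0 < N by rewrite ltr0n.
have sizeE : size E = n by apply: size_eigenvalues.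
(* As n > 0, index [n.-1] is in range, so s_n = 0 is a genuine deviation and not the default value
   of [nth]. *)
have mu_in : mu \in E.
  have : (Aalpha_dev e alpha)`_n.-1 \in dev.
    by apply: mem_nth_sort; rewrite size_map sizeE prednK.
  by rewrite sn0 => /mapP[p pE /esym/normr0_eq0/subr0_eq <-].
have dev_le : {in dev, forall x, 0 <= x <= s1}.
  by move=> x x_dev; rewrite nth_sort_ge // andbT; case/mapP: x_dev => p _ ->.
have devP (P : R -> Prop) : {in dev, forall x, P x} <-> {in E, forall p, P `|p - mu|}.
  split=> [devP p pE | EP x /mapP[p pE ->]]; last exact: EP.
  by apply: devP; apply: map_f.
have energyE : Aalpha_energy e alpha = \sum_(x <- dev) x by rewrite big_map.
have boundE : bound = (\sum_(x <- dev) x ^+ 2) / s1.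
  rewrite /bound -(sum_sqr_dev_mean alpha Gsimple n_gt0) big_map.
  by congr (_ / _); apply: eq_bigr => p _; rewrite real_normK ?num_real.
have p_neq : exists2 p, p \in E & p != mu.
  have : s1 \in dev by apply: mem_nth_sort; rewrite size_map sizeE.
  case/mapP=> p pE s1E; exists p => //; apply/eqP=> p_mu.
  by move: s1_gt0; rewrite s1E p_mu subrr normr0 ltxx.
pose spectrum := centered_spectrum e alpha.
(* The witness is h = s_1. Conversely s_1 is an attained nonzero deviation, which leaves only h. *)
have equality : Aalpha_energy e alpha = bound <-> exists2 h, 0 < h & spectrum h.
  rewrite energyE boundE (sum_sqr_div_eq s1_gt0 dev_le) devP.
  split=> [dev_s1|[h h_gt0 /(spectrum_dev Gsimple h_gt0) devh]].
    by exists s1 => //; apply: dev_spectrum.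
  suff -> : s1 = h by [].
  have : s1 \in dev by apply: mem_nth_sort; rewrite size_map sizeE.
  by case/mapP=> p pE s1E; move: s1_gt0; rewrite s1E; case: (devh p pE) => ->; rewrite ?ltxx.
have iE : spectrum_i <->
    exists2 k : nat, n = (2 * k)%N & graph_iso e (@complete_bipartite k k).
  split=> [spec_i|[k _ /iso_bipartition[X]]]; last exact: bipartition_spectrum.
  have [spec sizeN] := spectrum_balanced Gsimple Gconn alpha_lt1 mu_in spec_i.
  have h_gt0 : 0 < (1 - alpha) * N / 2 by rewrite divr_gt0 ?mulr_gt0 ?subr_gt0.
  have [k [X biX]] := spectrum_size_eq Gsimple Gconn alpha_lt1 h_gt0 spec sizeN.
  by exists k; [apply: bipartition_order biX | apply: bipartition_iso biX].
have m_muE : 2 * m * alpha / N = mu by rewrite /mu /Aalpha_mean (mulrAC 2).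
split=> //.
  by rewrite energyE boundE; exact: sum_sqr_div_le s1_gt0 dev_le.
(* The cases separate at h = (2 m / n) (1 - alpha): equality leads to (i), a larger h to (ii). *)
rewrite equality; split=> [[h h_gt0 spec]|[spec_i|[h h_gt spec]]].
- have := spectrum_size_le Gsimple Gconn h_gt0 spec.
  rewrite le_eqVlt => /orP[/eqP sizeE'|size_lt]; last first.
    by right; exists h; [rewrite mulrAC ltr_pdivrMr | rewrite m_muE].
  have [k [X biX]] := spectrum_size_eq Gsimple Gconn alpha_lt1 h_gt0 spec sizeE'.
  by left; apply: bipartition_spectrum biX.
- have [spec _] := spectrum_balanced Gsimple Gconn alpha_lt1 mu_in spec_i.
  by exists ((1 - alpha) * N / 2) => //; rewrite divr_gt0 ?mulr_gt0 ?subr_gt0.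
- exists h; last by rewrite m_muE in spec.
  apply: le_lt_trans h_gt.
  by rewrite !mulr_ge0 ?invr_ge0 ?subr_ge0 ?ler0n // ltW.
Qed.
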